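(* Let $\mathbb K$ be a field, $H$ a Hopf algebra over $\mathbb K$ with invertible antipode, $K$ a Hopf algebra over $\mathbb K$, and $A$ a $(K,H)$-bicomodule algebra such that $B=A^{coH}$ is a $K$-subcomodule of $A$. Let $\sigma:K\otimes K\to\mathbb K$ be a 2-cocycle on $K$. Then $A$ is a principal $H$-comodule algebra if and only if ${}_\sigma A$ is a principal $H$-comodule algebra.
   Context: $\otimes=\otimes_{\mathbb K}$; Sweedler notation $\Delta(h)=h_{(1)}\otimes h_{(2)}$, right $H$-coactions $\delta(v)=v_{(0)}\otimes v_{(1)}$, left $K$-coactions $\rho(v)=v_{(-1)}\otimes v_{(0)}$. A $(K,H)$-bicomodule algebra is a unital associative algebra with a left $K$-coaction $\rho$ and a right $H$-coaction $\delta$, both unital algebra maps, with $(\rho\otimes\mathrm{id})\delta=(\mathrm{id}\otimes\delta)\rho$. $A^{coH}=\{b\in A:\delta^A(b)=b\otimes1_H\}$. That $B$ is a $K$-subcomodule means $\rho^A$ restricts to a left $K$-coaction $B\to K\otimes B$. A principal $H$-comodule algebra is a right $H$-comodule algebra $A$ (algebra with a right $H$-coaction that is a unital algebra map) such that, with $B:=A^{coH}$: (1) the canonical map $A\otimes_BA\to A\otimes H$, $a\otimes_Ba'\mapsto aa'_{(0)}\otimes a'_{(1)}$ is bijective ($H$-Hopf-Galois); (2) there exists a left $B$-module and right $H$-comodule morphism $s:A\to B\otimes A$ (left $B$-action by multiplication on the first factor, tensor product coaction, trivial on $B$) with $m\circ s=\mathrm{id}_A$, where $m:B\otimes A\to A$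 is the restricted product. A 2-cocycle on $K$ is a convolution invertible $\mathbb K$-linear map $\sigma:K\otimes K\to\mathbb K$ with $\sigma(k\otimes1)=\varepsilon(k)=\sigma(1\otimes k)$ and $\sigma(g_{(1)}\otimes h_{(1)})\sigma(g_{(2)}h_{(2)}\otimes k)=\sigma(h_{(1)}\otimes k_{(1)})\sigma(g\otimes h_{(2)}k_{(2)})$ for all $g,h,k\in K$. ${}_\sigma A$ is the right $H$-comodule algebra with the module, unit and right $H$-coaction of $A$ and product $a\,{}_\sigma\!\bullet\,a'=\sigma(a_{(-1)}\otimes a'_{(-1)})a_{(0)}a'_{(0)}$. *)

(* Defs.v *)
From HB Require Import structures.
From mathcomp Require Import all_boot all_algebra.
From mathcomp Require Import boolp.

Set Implicit Arguments.
Unset Strict Implicit.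
Unset Printing Implicit Defensive.

Import GRing.Theory.
Local Open Scope ring_scope.
Local Open Scope quotient_scope.

(* [btensor ra la] is the tensor product V (x)_R W of a right R-module V      *)
(* (action ra) and a left R-module W (action la): formal finite sums of       *)
(* pairs, modulo the congruence generated by biadditivity and R-balancedness. *)
Section BalancedTensor.
Variables (R : Type) (V W : zmodType) (ra : V -> R -> V) (la : R -> W -> W).
Implicit Types (s t : seq (V * W)).

Inductive tens_rel : seq (V * W) -> seq (V * W) -> Prop :=
| tens_refl s : tens_rel s s
| tens_sym s t : tens_rel s t -> tens_rel t s
| tens_trans s t u : tens_rel s t -> tens_rel t u -> tens_rel s u
| tens_perm s t : perm_eq s t -> tens_rel s t
| tens_cat s s' t : tens_rel s s' -> tens_rel (s ++ t) (s' ++ t)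
| tens_0l w : tens_rel [:: (0, w)] [::]
| tens_addl v v' w : tens_rel [:: (v + v', w)] [:: (v, w); (v', w)]
| tens_addr v w w' : tens_rel [:: (v, w + w')] [:: (v, w); (v, w')]
| tens_bal v r w : tens_rel [:: (ra v r, w)] [:: (v, la r w)].

Definition tens_eqb : rel (seq (V * W)) := fun s t => `[< tens_rel s t >].

Lemma tens_eqb_refl : reflexive tens_eqb.
Proof. by move=> s; apply/asboolP; apply: tens_refl. Qed.

Lemma tens_eqb_sym : symmetric tens_eqb.
Proof.
by move=> s t; apply/asboolP/asboolP; apply: tens_sym.
Qed.

Lemma tens_eqb_trans : transitive tens_eqb.
Proof.
move=> t s u /asboolP st /asboolP tu; apply/asboolP.
exact: tens_trans st tu.
Qed.

Canonical tens_equiv := EquivRel tens_eqb tens_eqb_refl tens_eqb_sym tens_eqb_trans.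

Definition btensor : Type := {eq_quot tens_equiv}.
HB.instance Definition _ := Choice.on btensor.
HB.instance Definition _ := EqQuotient.on btensor.

Lemma btensorP s t : tens_rel s t <-> \pi_btensor s = \pi_btensor t.
Proof.
split=> [st|/eqmodP /asboolP //].
by apply/eqmodP; apply/asboolP.
Qed.

Lemma repr_rel s : tens_rel (repr (\pi_btensor s)) s.
Proof. by apply/btensorP; rewrite reprK. Qed.

Lemma btensor_pi (P : btensor -> Prop) :
  (forall s, P (\pi_btensor s)) -> forall x, P x.
Proof. by move=> Ppi x; rewrite -(reprK x). Qed.

Lemma tens_cat2 s s' t t' :
  tens_rel s s' -> tens_rel t t' -> tens_rel (s ++ t) (s' ++ t').
Proof.
move=> ss' tt'; apply: (tens_trans (tens_cat t ss')).
apply: (tens_trans (tens_perm _)); first by rewrite perm_catC.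
apply: (tens_trans (tens_cat s' tt')).
by apply: tens_perm; rewrite perm_catC.
Qed.

Definition btens (v : V) (w : W) : btensor := \pi_btensor [:: (v, w)].
Definition btensor_zero : btensor := \pi_btensor [::].
Definition btensor_add (x y : btensor) : btensor := \pi_btensor (repr x ++ repr y).
Definition btensor_opp (x : btensor) : btensor :=
  \pi_btensor [seq (- p.1, p.2) | p <- repr x].

Lemma btensor_addE s t : btensor_add (\pi_btensor s) (\pi_btensor t) = \pi_btensor (s ++ t).
Proof. by apply/btensorP/tens_cat2; apply: repr_rel. Qed.

Lemma btensor_addA : associative btensor_add.
Proof.
elim/btensor_pi=> s; elim/btensor_pi=> t; elim/btensor_pi=> u.
rewrite (btensor_addE t u) (btensor_addE s (t ++ u)) (btensor_addE s t).
by rewrite (btensor_addE (s ++ t) u) catA.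
Qed.

Lemma btensor_addC : commutative btensor_add.
Proof.
elim/btensor_pi=> s; elim/btensor_pi=> t.
rewrite (btensor_addE s t) (btensor_addE t s).
by apply/btensorP/tens_perm; rewrite perm_catC.
Qed.

Lemma btensor_add0 : left_id btensor_zero btensor_add.
Proof. by elim/btensor_pi=> s; rewrite (btensor_addE [::] s). Qed.

Lemma tens_oppN s : tens_rel ([seq (- p.1, p.2) | p <- s] ++ s) [::].
Proof.
elim: s => [|[v w] s IHs]; first exact: tens_refl.
have vw : tens_rel [:: (- v, w); (v, w)] [::].
  apply: tens_trans (tens_0l w).
  by rewrite -(addNr v); apply/tens_sym/tens_addl.
apply: tens_trans (tens_cat2 vw IHs); apply: tens_perm => /=.
by rewrite perm_cons -cat_rcons -cat_cons perm_cat2r perm_rcons.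
Qed.

Lemma btensor_addN : left_inverse btensor_zero btensor_opp btensor_add.
Proof.
move=> x; rewrite -{2}(reprK x) (btensor_addE _ (repr x)).
by apply/btensorP/tens_oppN.
Qed.

HB.instance Definition _ := GRing.isZmodule.Build btensor
  btensor_addA btensor_addC btensor_add0 btensor_addN.

Lemma btensorE (x : btensor) : x = \sum_(p <- repr x) btens p.1 p.2.
Proof.
rewrite -{1}(reprK x); elim: (repr x) => [|[v w] s IHs]; first by rewrite big_nil.
by rewrite big_cons -IHs; apply/esym/(btensor_addE [:: (v, w)] s).
Qed.

(* Sweedler summation: [\sw_(v, w <- x) f v w] sums f over a chosen            *)
(* representative of x; it does not depend on the choice as soon as f is       *)
(* biadditive and balanced, see [sweedler_pi] below.                           *)
Definition sweedler (U : nmodType) (x : btensor) (f : V -> W -> U) : U :=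
  \sum_(p <- repr x) f p.1 p.2.

Definition balanced (U : zmodType) (f : V -> W -> U) : Prop :=
  [/\ forall v v' w, f (v + v') w = f v w + f v' w,
      forall v w w', f v (w + w') = f v w + f v w' &
      forall v r w, f (ra v r) w = f v (la r w)].

Lemma sweedler_pi (U : zmodType) (f : V -> W -> U) s :
  balanced f -> sweedler (\pi_btensor s) f = \sum_(p <- s) f p.1 p.2.
Proof.
move=> [fDl fDr fb]; rewrite /sweedler.
suff sum_rel t t' : tens_rel t t' ->
  \sum_(p <- t) f p.1 p.2 = \sum_(p <- t') f p.1 p.2 by exact/sum_rel/repr_rel.
elim=> {s t t'} //=.
- by move=> s t u _ -> _ ->.
- by move=> s t st; apply: perm_big.
- by move=> s s' t _ IH; rewrite !big_cat /= IH.
- move=> w; rewrite big_seq1 big_nil /=.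
  by apply: (addrI (f 0 w)); rewrite -fDl !addr0.
- by move=> v v' w; rewrite !big_cons !big_nil !addr0 /= fDl.
- by move=> v w w'; rewrite !big_cons !big_nil !addr0 /= fDr.
- by move=> v r w; rewrite !big_seq1 /= fb.
Qed.

Lemma sweedler_btens (U : zmodType) (f : V -> W -> U) v w :
  balanced f -> sweedler (btens v w) f = f v w.
Proof. by move=> fb; rewrite sweedler_pi // big_seq1. Qed.

Lemma sweedlerD (U : zmodType) (f : V -> W -> U) x y :
  balanced f -> sweedler (x + y) f = sweedler x f + sweedler y f.
Proof.
by move=> fb; rewrite (sweedler_pi _ fb) big_cat.
Qed.

Lemma btens_balanced : balanced btens.
Proof.
split=> [v v' w|v w w'|v r w].
- rewrite -[RHS]/(btensor_add _ _) (btensor_addE [:: (v, w)]).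
  exact/btensorP/tens_addl.
- rewrite -[RHS]/(btensor_add _ _) (btensor_addE [:: (v, w)]).
  exact/btensorP/tens_addr.
- exact/btensorP/tens_bal.
Qed.

End BalancedTensor.

Arguments btensor {R V W} ra la.
Arguments btens {R V W} ra la v w.
Arguments sweedler {R V W ra la U} x f.

Reserved Notation "\sw_ ( v , w <- x ) E"
  (at level 41, v name, w name, x at level 100, E at level 41,
   format "'[' \sw_ ( v ,  w  <-  x ) '/  '  E ']'").
Notation "\sw_ ( v , w <- x ) E" := (sweedler x (fun v w => E)) : ring_scope.

Section Tensor.
Variables (k : fieldType) (V W : lmodType k).

Local Notation tra := (fun (v : V) (c : k) => c *: v).
Local Notation tla := (fun (c : k) (w : W) => c *: w).

Definition tensor : Type := btensor tra tla.
HB.instance Definition _ := GRing.Zmodule.on tensor.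

Definition tens (v : V) (w : W) : tensor := btens _ _ v w.

Definition bilin (U : lmodType k) (f : V -> W -> U) : Prop :=
  (forall w, linear (f^~ w)) /\ (forall v, linear (f v)).

Lemma linear_add (X Y : lmodType k) (g : X -> Y) :
  linear g -> forall u v, g (u + v) = g u + g v.
Proof. by move=> gl u v; have := gl 1 u v; rewrite !scale1r. Qed.

Lemma linear_scale (X Y : lmodType k) (g : X -> Y) :
  linear g -> forall c u, g (c *: u) = c *: g u.
Proof.
move=> gl c u; have := gl c u 0; rewrite !addr0 => ->.
suff -> : g 0 = 0 by rewrite addr0.
by apply: (addrI (g 0)); rewrite -(linear_add gl) !addr0.
Qed.

Lemma bilin_balanced (U : lmodType k) (f : V -> W -> U) : bilin f ->
  balanced tra tla f.
Proof.
move=> [fl fr]; split=> [v v' w|v w w'|v c w].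
- exact: linear_add (fl w) _ _.
- exact: linear_add (fr v) _ _.
- by rewrite (linear_scale (fl w)) (linear_scale (fr v)).
Qed.

Definition tensor_scale (c : k) (x : tensor) : tensor :=
  \sw_(v, w <- x) tens (c *: v) w.

Lemma tensDl v v' w : tens (v + v') w = tens v w + tens v' w.
Proof. by have [bDl _ _] := btens_balanced tra tla; apply: bDl. Qed.

Lemma tensDr v w w' : tens v (w + w') = tens v w + tens v w'.
Proof. by have [_ bDr _] := btens_balanced tra tla; apply: bDr. Qed.

Lemma tensZ c v w : tens (c *: v) w = tens v (c *: w).
Proof. by have [_ _ bZ] := btens_balanced tra tla; apply: bZ. Qed.

Lemma tens_scale_balanced c : balanced tra tla (fun v w => tens (c *: v) w).
Proof.
split=> [v v' w|v w w'|v d w]; first by rewrite scalerDr tensDl.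
  by rewrite tensDr.
by rewrite -tensZ !scalerA mulrC.
Qed.

Lemma tensor_scaleE c v w : tensor_scale c (tens v w) = tens (c *: v) w.
Proof. exact/sweedler_btens/tens_scale_balanced. Qed.

Lemma tensor_scaleDr c : {morph tensor_scale c : x y / x + y}.
Proof. by move=> x y; apply/sweedlerD/tens_scale_balanced. Qed.

Lemma tensor_scale0 c : tensor_scale c 0 = 0.
Proof.
by apply: (addrI (tensor_scale c 0)); rewrite -tensor_scaleDr !addr0.
Qed.

Lemma tensor_ind (P : tensor -> Prop) :
  P 0 -> (forall v w x, P x -> P (tens v w + x)) -> forall x, P x.
Proof.
move=> P0 PD x; rewrite (btensorE x).
elim: (repr x) => [|p s IHs]; first by rewrite big_nil.
by rewrite big_cons; apply: PD.
Qed.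

Lemma tensor_scaleA c d x :
  tensor_scale c (tensor_scale d x) = tensor_scale (c * d) x.
Proof.
elim/tensor_ind: x => [|v w x IHx]; first by rewrite !tensor_scale0.
by rewrite !tensor_scaleDr IHx !tensor_scaleE scalerA.
Qed.

Lemma tensor_scale1 : left_id 1 tensor_scale.
Proof.
elim/tensor_ind => [|v w x IHx]; first by rewrite !tensor_scale0.
by rewrite tensor_scaleDr IHx tensor_scaleE scale1r.
Qed.

Lemma tensor_scaleDl x : {morph tensor_scale^~ x : c d / c + d}.
Proof.
move=> c d /=.
elim/tensor_ind: x => [|v w x IHx]; first by rewrite !tensor_scale0 addr0.
by rewrite !tensor_scaleDr IHx !tensor_scaleE scalerDl tensDl addrACA.
Qed.

HB.instance Definition _ := GRing.Zmodule_isLmodule.Build k tensor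
  tensor_scaleA tensor_scale1 tensor_scaleDr tensor_scaleDl.

Lemma tens_bilin : bilin tens.
Proof.
split=> [w c v v'|v c w w']; first by rewrite tensDl -tensor_scaleE.
by rewrite tensDr -tensZ -tensor_scaleE.
Qed.

Lemma tens_linl w : linear (tens^~ w).
Proof. by case: tens_bilin. Qed.

Lemma tens_linr v : linear (tens v).
Proof. by case: tens_bilin. Qed.

Lemma sw_tens (U : lmodType k) (f : V -> W -> U) v w :
  bilin f -> sweedler (tens v w) f = f v w.
Proof. by move=> /bilin_balanced fb; apply: sweedler_btens. Qed.

Lemma sw_linear (U : lmodType k) (f : V -> W -> U) :
  bilin f -> linear (fun x : tensor => sweedler x f).
Proof.
move=> fb c x y; have bf := bilin_balanced fb.
rewrite (sweedlerD _ _ bf); congr (_ + _) => {y}.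
elim/tensor_ind: x => [|v w x IHx].
  have s0 : sweedler (0 : tensor) f = 0.
    by apply: (addrI (sweedler (0 : tensor) f)); rewrite -(sweedlerD _ _ bf) !addr0.
  by rewrite scaler0 s0 scaler0.
rewrite scalerDr !(sweedlerD _ _ bf) IHx scalerDr; congr (_ + _).
have -> : c *: tens v w = tens (c *: v) w by exact: tensor_scaleE.
by rewrite !sw_tens //; case: fb => fl _; rewrite (linear_scale (fl w)).
Qed.

Lemma sw_id (x : tensor) : \sw_(v, w <- x) tens v w = x.
Proof. by rewrite [RHS]btensorE. Qed.

End Tensor.

Arguments tens {k V W} v w.

Notation "V ⊗ W" := (tensor V%type W%type) (at level 40, left associativity) : type_scope.
Notation "v ⊗ w" := (tens v w) (at level 40, left associativity) : ring_scope.


Definition tmul (k : fieldType) (V W : lmodType k) (mV : V -> V -> V)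
    (mW : W -> W -> W) (x y : V ⊗ W) : V ⊗ W :=
  \sw_(v, w <- x) \sw_(v', w' <- y) mV v v' ⊗ mW w w'.

HB.mixin Record Algebra_isHopf (k : fieldType) H of GRing.Algebra k H := {
  comul : {linear H -> (H ⊗ H)%type};
  counit : {scalar H};
  antipode : {linear H -> H};
  comulA : forall h : H,
    \sw_(h1, h2 <- comul h) \sw_(h11, h12 <- comul h1) h11 ⊗ (h12 ⊗ h2) =
    \sw_(h1, h2 <- comul h) \sw_(h21, h22 <- comul h2) h1 ⊗ (h21 ⊗ h22);
  counitl : forall h : H, \sw_(h1, h2 <- comul h) counit h1 *: h2 = h;
  counitr : forall h : H, \sw_(h1, h2 <- comul h) counit h2 *: h1 = h;
  comul1 : comul 1 = 1 ⊗ 1;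
  comulM : forall g h : H, comul (g * h) = tmul *%R *%R (comul g) (comul h);
  counit1 : counit 1 = 1;
  counitM : forall g h : H, counit (g * h) = counit g * counit h;
  antipodel : forall h : H,
    \sw_(h1, h2 <- comul h) antipode h1 * h2 = (counit h)%:A;
  antipoder : forall h : H,
    \sw_(h1, h2 <- comul h) h1 * antipode h2 = (counit h)%:A
}.

#[short(type="hopfAlgType")]
HB.structure Definition HopfAlgebra (k : fieldType) :=
  {H of GRing.Algebra k H & Algebra_isHopf k H}.

(* Unital associative algebras; MathComp's [algType] demands in addition that *)
(* 1 != 0, which holds in every Hopf algebra but may fail for a comodule      *)
(* algebra.                                                                   *)
Record assocAlg (k : fieldType) := AssocAlg {
  aa_lmod :> lmodType k;
  amul : aa_lmod -> aa_lmod -> aa_lmod;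
  aone : aa_lmod;
  amulA : associative amul;
  amul1x : left_id aone amul;
  amulx1 : right_id aone amul;
  amul_bilin : bilin amul
}.
Arguments aone {k} A : rename.
Arguments amul {k A} a b : rename.
Notation "a ∙ b" := (amul a b) (at level 40, left associativity) : ring_scope.

Section Coactions.
Variables (k : fieldType) (H : hopfAlgType k) (V : lmodType k).

Definition is_rcoaction (d : {linear V -> (V ⊗ H)%type}) : Prop :=
  (forall v, \sw_(v0, v1 <- d v) \sw_(v00, v01 <- d v0) v00 ⊗ (v01 ⊗ v1) =
             \sw_(v0, v1 <- d v) \sw_(h1, h2 <- comul v1) v0 ⊗ (h1 ⊗ h2)) /\
  (forall v, \sw_(v0, v1 <- d v) counit v1 *: v0 = v).

Definition is_lcoaction (r : {linear V -> (H ⊗ V)%type}) : Prop :=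
  (forall v, \sw_(v1, v0 <- r v) \sw_(h1, h2 <- comul v1) h1 ⊗ (h2 ⊗ v0) =
             \sw_(v1, v0 <- r v) \sw_(v01, v00 <- r v0) v1 ⊗ (v01 ⊗ v00)) /\
  (forall v, \sw_(v1, v0 <- r v) counit v1 *: v0 = v).

End Coactions.

Record rcomodAlg (k : fieldType) (H : hopfAlgType k) := RComodAlg {
  rca_alg :> assocAlg k;
  rcoact : {linear rca_alg -> (rca_alg ⊗ H)%type};
  rcoactP : is_rcoaction rcoact;
  rcoact1 : rcoact (aone rca_alg) = aone rca_alg ⊗ 1;
  rcoactM : forall a b,
    rcoact (a ∙ b) = tmul amul *%R (rcoact a) (rcoact b)
}.
Arguments rcoact {k H A} : rename.

Record bicomodAlg (k : fieldType) (L H : hopfAlgType k) := BicomodAlg {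
  bca_rca :> rcomodAlg H;
  lcoact : {linear bca_rca -> (L ⊗ bca_rca)%type};
  lcoactP : is_lcoaction lcoact;
  lcoact1 : lcoact (aone bca_rca) = 1 ⊗ aone bca_rca;
  lcoactM : forall a b,
    lcoact (a ∙ b) = tmul *%R amul (lcoact a) (lcoact b);
  bicoactP : forall a,
    \sw_(a0, h <- rcoact a) \sw_(l, a' <- lcoact a0) l ⊗ (a' ⊗ h) =
    \sw_(l, a0 <- lcoact a) \sw_(a', h <- rcoact a0) l ⊗ (a' ⊗ h)
}.
Arguments lcoact {k L H A} : rename.

Section Sums.
Variables (k : fieldType) (V W : lmodType k).
Implicit Types (U X : lmodType k) (t : V ⊗ W).

Lemma eq_sw (U : nmodType) t (f g : V -> W -> U) :
  (forall v w, f v w = g v w) -> sweedler t f = sweedler t g.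
Proof. by move=> fg; apply: eq_bigr => p _; apply: fg. Qed.

Lemma sw_map U X (g : U -> X) t (f : V -> W -> U) :
  linear g -> g (sweedler t f) = \sw_(v, w <- t) g (f v w).
Proof.
move=> gl; apply: (big_morph g) => [x y|]; first exact: linear_add.
by rewrite -(scale0r 0) (linear_scale gl) scale0r.
Qed.

Lemma sw_exchange (V' W' : lmodType k) (U : nmodType) t (t' : V' ⊗ W')
    (f : V -> W -> V' -> W' -> U) :
  \sw_(v, w <- t) \sw_(v', w' <- t') f v w v' w' =
  \sw_(v', w' <- t') \sw_(v, w <- t) f v w v' w'.
Proof. exact: exchange_big. Qed.

Lemma sw_lin U X t (F : X -> V -> W -> U) :
  (forall v w, linear (fun x => F x v w)) -> linear (fun x => sweedler t (F x)).
Proof.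
move=> Fl c x y; rewrite /sweedler scaler_sumr -big_split /=.
by apply: eq_bigr => p _; apply: Fl.
Qed.

Lemma sw_linl U X (t : X -> V ⊗ W) (f : V -> W -> U) :
  linear t -> bilin f -> linear (fun x => sweedler (t x) f).
Proof. by move=> tl fb c x y; rewrite tl; apply: sw_linear. Qed.

End Sums.

Section Linearity.
Variables (k : fieldType) (X V W U : lmodType k).

Lemma lin_id : linear (fun x : X => x).
Proof. by []. Qed.

Lemma lin_linear (f : {linear V -> U}) (g : X -> V) :
  linear g -> linear (fun x => f (g x)).
Proof. by move=> gl c x y; rewrite gl linearP. Qed.

Lemma lin_scalel (f : {scalar V}) (g : X -> V) (u : U) :
  linear g -> linear (fun x => f (g x) *: u).
Proof. by move=> gl c x y; rewrite gl linearP scalerDl scalerA. Qed.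

Lemma lin_scaler (c : k) (g : X -> V) :
  linear g -> linear (fun x => c *: g x).
Proof. by move=> gl d x y; rewrite gl scalerDr !scalerA mulrC. Qed.

Lemma bilin_linl (f : V -> W -> U) (g : X -> V) w :
  bilin f -> linear g -> linear (fun x => f (g x) w).
Proof. by move=> [fl _] gl c x y; rewrite gl; apply: fl. Qed.

Lemma bilin_linr (f : V -> W -> U) (g : X -> W) v :
  bilin f -> linear g -> linear (fun x => f v (g x)).
Proof. by move=> [_ fr] gl c x y; rewrite gl; apply: fr. Qed.

Lemma mul_bilin (H : algType k) : bilin ( *%R : H -> H -> H).
Proof.
split=> [h c x y|h c x y] /=; first by rewrite mulrDl scalerAl.
by rewrite mulrDr scalerAr.
Qed.

End Linearity.

Section Trilinear.
Variables (k : fieldType) (V1 V2 V3 U : lmodType k) (f : V1 -> V2 -> V3 -> U).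

Definition trilin : Prop :=
  [/\ forall y z, linear (fun x => f x y z),
      forall x z, linear (fun y => f x y z) &
      forall x y, linear (fun z => f x y z)].

Definition lift3 (t : V1 ⊗ (V2 ⊗ V3)) : U :=
  \sw_(x, u <- t) \sw_(y, z <- u) f x y z.

Hypothesis f_trilin : trilin.

Lemma trilin_bilin x : bilin (f x).
Proof. by case: f_trilin => _ f2 f3; split=> y; [apply: f2 | apply: f3]. Qed.

Lemma lift3_bilin : bilin (fun x (u : V2 ⊗ V3) => \sw_(y, z <- u) f x y z).
Proof.
case: (f_trilin) => f1 _ _; split=> [u|x].
  by apply: sw_lin => y z; apply: f1.
by apply: sw_linear; apply: trilin_bilin.
Qed.

Lemma lift3_linear : linear lift3.
Proof. by apply: sw_linear; apply: lift3_bilin. Qed.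

Lemma lift3_tens x y z : lift3 (x ⊗ (y ⊗ z)) = f x y z.
Proof.
by rewrite /lift3 (sw_tens _ _ lift3_bilin) (sw_tens _ _ (trilin_bilin x)).
Qed.

End Trilinear.

Ltac lin :=
  cbv beta;
  match goal with
  | |- bilin (@tens _ _ _) => exact: tens_bilin
  | |- bilin (@amul _ _) => exact: amul_bilin
  | |- bilin _ => split=> ?; lin
  | |- trilin _ => split=> ? ?; lin
  | |- GRing.linear_for _ (fun x => x) => exact: lin_id
  | |- GRing.linear_for _ (GRing.Linear.sort _) => exact: linearP
  | |- GRing.linear_for _ (tens ?v) => exact: (tens_bilin _ _).2
  | |- GRing.linear_for _ (amul ?v) => exact: (amul_bilin _).2
  | |- GRing.linear_for _ (GRing.mul ?v) => exact: (mul_bilin _).2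
  | |- GRing.linear_for _ (fun x => sweedler ?t _) => apply: sw_lin => ? ?; lin
  | |- GRing.linear_for _ (fun x => sweedler _ _) => apply: sw_linl; lin
  | |- GRing.linear_for _ (fun x => _ *: ?u) => apply: lin_scalel; lin
  | |- GRing.linear_for _ (fun x => ?c *: _) => apply: lin_scaler; lin
  | |- GRing.linear_for _ (fun x => tens (@?g x) ?w) =>
      refine (@bilin_linl _ _ _ _ _ _ g w (tens_bilin _ _) _); lin
  | |- GRing.linear_for _ (fun x => tens ?v (@?g x)) =>
      refine (@bilin_linr _ _ _ _ _ _ g v (tens_bilin _ _) _); lin
  | |- GRing.linear_for _ (fun x => amul (@?g x) ?w) =>
      refine (@bilin_linl _ _ _ _ _ _ g w (amul_bilin _) _); lin
  | |- GRing.linear_for _ (fun x => amul ?v (@?g x)) =>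
      refine (@bilin_linr _ _ _ _ _ _ g v (amul_bilin _) _); lin
  | |- GRing.linear_for _ (fun x => (@?g x) * ?w) =>
      refine (@bilin_linl _ _ _ _ _ _ g w (mul_bilin _) _); lin
  | |- GRing.linear_for _ (fun x => ?v * (@?g x)) =>
      refine (@bilin_linr _ _ _ _ _ _ g v (mul_bilin _) _); lin
  | |- GRing.linear_for _ (fun x => GRing.Linear.sort ?f (@?g x)) =>
      refine (@lin_linear _ _ _ _ f g _); lin
  | |- _ => idtac
  end.


Section SweedlerLemmas.
Variables (k : fieldType).
Implicit Types (U : lmodType k).

Lemma tmulE (V W : lmodType k) (mV : V -> V -> V) (mW : W -> W -> W) U
    (F : V -> W -> U) (x y : V ⊗ W) : bilin F ->
  sweedler (tmul mV mW x y) F =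
  \sw_(v, w <- x) \sw_(v', w' <- y) F (mV v v') (mW w w').
Proof.
move=> F2; pose G (t : V ⊗ W) := sweedler t F.
have Gl : linear G by apply: sw_linear.
rewrite -/(G _) /tmul (sw_map _ _ Gl); apply: eq_sw => v w.
by rewrite (sw_map _ _ Gl); apply: eq_sw => v' w'; rewrite /G sw_tens.
Qed.

Lemma scale_sw (V W : lmodType k) U (x : V ⊗ W) (f : V -> W -> U) d :
  d *: sweedler x f = \sw_(v, w <- x) d *: f v w.
Proof. exact: scaler_sumr. Qed.

Lemma sw_scale (V W : lmodType k) U (x : V ⊗ W) (f : V -> W -> k) (u : U) :
  (sweedler x f) *: u = \sw_(v, w <- x) f v w *: u.
Proof. exact: scaler_suml. Qed.

End SweedlerLemmas.

Section Principal.
Variables (k : fieldType) (H : hopfAlgType k) (A : rcomodAlg H).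

Definition is_coinv : {pred A} := fun a => rcoact a == a ⊗ 1.

Record coinv := Coinv {coinv_val : A; _ : coinv_val \in is_coinv}.
HB.instance Definition _ := [isSub for coinv_val].
HB.instance Definition _ := [Choice of coinv by <:].

Lemma coinvP (b : coinv) : rcoact (val b) = val b ⊗ 1.
Proof. by apply/eqP; case: b. Qed.

Lemma is_coinv_submod : submod_closed is_coinv.
Proof.
split=> [|c a b]; rewrite !unfold_in.
  by rewrite linear0 -[X in _ == X ⊗ _](scale0r 0) (linear_scale (tens_linl _)) scale0r.
by move=> /eqP da /eqP db; rewrite linearP da db [eqbRHS](tens_linl _).
Qed.
HB.instance Definition _ := GRing.isSubmodClosed.Build k A is_coinv is_coinv_submod.
HB.instance Definition _ := [SubChoice_isSubLmodule of coinv by <:].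

Lemma tmul_tens (a a' : A) (h h' : H) :
  tmul amul *%R (a ⊗ h) (a' ⊗ h') = (a ∙ a') ⊗ (h * h').
Proof.
rewrite /tmul sw_tens; last by lin.
by rewrite sw_tens //; lin.
Qed.

Lemma coinv_mulP (b b' : coinv) : val b ∙ val b' \in is_coinv.
Proof.
by rewrite unfold_in rcoactM !coinvP tmul_tens mulr1.
Qed.

Definition coinv_mul (b b' : coinv) : coinv := Coinv (coinv_mulP b b').

(* A (x)_B A for B = coinv.                                                    *)
Definition tensorB : Type :=
  btensor (fun (a : A) (b : coinv) => a ∙ val b)
          (fun (b : coinv) (a : A) => val b ∙ a).

(* a (x)_B a' |-> a a'_(0) (x) a'_(1); well defined by [canonical_balanced].   *)
Definition canonical_map (x : tensorB) : A ⊗ H :=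
  \sw_(a, a' <- x) \sw_(a0, a1 <- rcoact a') (a ∙ a0) ⊗ a1.

Lemma canonical_balanced :
  balanced (fun (a : A) (b : coinv) => a ∙ val b)
           (fun (b : coinv) (a : A) => val b ∙ a)
           (fun a a' => \sw_(a0, a1 <- rcoact a') (a ∙ a0) ⊗ a1).
Proof.
have F2 (a : A) : bilin (fun a0 (a1 : H) => (a ∙ a0) ⊗ a1) by lin.
have Fl (a' : A) : linear (fun a : A => \sw_(a0, a1 <- rcoact a') (a ∙ a0) ⊗ a1).
  by lin.
have Fr (a : A) : linear (fun a' : A => \sw_(a0, a1 <- rcoact a') (a ∙ a0) ⊗ a1).
  by lin.
split=> [a b a'|a a' b'|a b a'].
- exact: linear_add (Fl a') _ _.
- exact: linear_add (Fr a) _ _.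
rewrite rcoactM coinvP (tmulE _ _ _ _ (F2 a)) sw_tens; last by lin.
by apply: eq_sw => a0 a1; rewrite amulA mul1r.
Qed.

Definition hopf_galois : Prop := bijective canonical_map.

(* B (x) A carries the left B-action on the first factor, and the coaction of  *)
(* A on the second one since B is coacted upon trivially.                      *)
Definition coinv_act (b : coinv) (x : coinv ⊗ A) : coinv ⊗ A :=
  \sw_(b', a <- x) coinv_mul b b' ⊗ a.

Definition coinv_coact (x : coinv ⊗ A) : (coinv ⊗ A) ⊗ H :=
  \sw_(b, a <- x) \sw_(a0, a1 <- rcoact a) (b ⊗ a0) ⊗ a1.

Definition principal : Prop :=
  hopf_galois /\
  exists s : {linear A -> (coinv ⊗ A)%type},
    [/\ forall b a, s (val b ∙ a) = coinv_act b (s a),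
        forall a, coinv_coact (s a) = \sw_(a0, a1 <- rcoact a) s a0 ⊗ a1 &
        forall a, \sw_(b, a' <- s a) val b ∙ a' = a].

End Principal.

Definition coinv_subcomodule (k : fieldType) (L H : hopfAlgType k)
    (A : bicomodAlg L H) : Prop :=
  exists2 r : {linear coinv A -> (L ⊗ coinv A)%type},
    is_lcoaction r &
    forall b, \sw_(l, b0 <- r b) l ⊗ val b0 = lcoact (val b).

Section Cocycle.
Variables (k : fieldType) (L : hopfAlgType k).

Definition convolution_inverse (s t : {scalar (L ⊗ L)%type}) : Prop :=
  forall g h,
    \sw_(g1, g2 <- comul g) \sw_(h1, h2 <- comul h)
      s (g1 ⊗ h1) * t (g2 ⊗ h2) = counit g * counit h.

Record cocycle := Cocycle {
  cocycle_val :> {scalar (L ⊗ L)%type};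
  cocycle_inv : exists t : {scalar (L ⊗ L)%type},
    convolution_inverse cocycle_val t /\ convolution_inverse t cocycle_val;
  cocyclel1 : forall l, cocycle_val (1 ⊗ l) = counit l;
  cocycler1 : forall l, cocycle_val (l ⊗ 1) = counit l;
  cocycleP : forall g h l,
    \sw_(g1, g2 <- comul g) \sw_(h1, h2 <- comul h)
      cocycle_val (g1 ⊗ h1) * cocycle_val ((g2 * h2) ⊗ l) =
    \sw_(h1, h2 <- comul h) \sw_(l1, l2 <- comul l)
      cocycle_val (h1 ⊗ l1) * cocycle_val (g ⊗ (h2 * l2))
}.

End Cocycle.

Section CocycleTwist.
Variables (k : fieldType) (L H : hopfAlgType k) (A : bicomodAlg L H).
Variable σ : cocycle L.
Implicit Types (U : lmodType k) (a b c : A).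

Definition twist_mul (a b : A) : A :=
  \sw_(l, a0 <- lcoact a) \sw_(l', b0 <- lcoact b) σ (l ⊗ l') *: (a0 ∙ b0).

Lemma twist_mul_bilin : bilin twist_mul.
Proof. by rewrite /twist_mul; lin. Qed.

Lemma lcoact_coassoc U (F : L -> L -> A -> U) a : trilin F ->
  \sw_(l, x <- lcoact a) \sw_(l', y <- lcoact x) F l l' y =
  \sw_(l, x <- lcoact a) \sw_(l1, l2 <- comul l) F l1 l2 x.
Proof.
move=> F3; have F3l := lift3_linear F3.
have [co _] := lcoactP A; have := congr1 (lift3 F) (co a).
rewrite !(sw_map _ _ F3l) => e; apply/esym; move: e.
under eq_sw do (rewrite (sw_map _ _ F3l); under eq_sw do rewrite (lift3_tens F3)).
under [in RHS]eq_sw do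
  (rewrite (sw_map _ _ F3l); under eq_sw do rewrite (lift3_tens F3)).
by [].
Qed.

Lemma sw_twist U (G : A -> U) a b : linear G ->
  G (twist_mul a b) =
  \sw_(l, x <- lcoact a) \sw_(m, y <- lcoact b) σ (l ⊗ m) *: G (x ∙ y).
Proof.
move=> Gl; rewrite /twist_mul (sw_map _ _ Gl); apply: eq_sw => l x.
by rewrite (sw_map _ _ Gl); apply: eq_sw => m y; rewrite (linear_scale Gl).
Qed.

Lemma sw_lcoact_twist U (F : L -> A -> U) a b : bilin F ->
  sweedler (lcoact (twist_mul a b)) F =
  \sw_(l, x <- lcoact a) \sw_(m, y <- lcoact b)
    \sw_(l1, l2 <- comul l) \sw_(m1, m2 <- comul m)
      σ (l1 ⊗ m1) *: F (l2 * m2) (x ∙ y).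
Proof.
move=> F2; pose G t := sweedler (lcoact t) F.
have Gl : linear G by apply: sw_linl => // c x y; rewrite linearP.
rewrite -/(G _) (sw_twist _ _ Gl) /G.
under eq_sw do under eq_sw do
  (rewrite lcoactM (tmulE _ _ _ _ F2) scale_sw; under eq_sw do rewrite scale_sw).
under eq_sw do rewrite sw_exchange.
under [RHS]eq_sw do rewrite sw_exchange.
have F_l (X : lmodType k) (g : X -> L) u : linear g -> linear (fun x => F (g x) u).
  by move=> gl; apply: (bilin_linl _ F2).
have F_r (X : lmodType k) (g : X -> A) u : linear g -> linear (fun x => F u (g x)).
  by move=> gl; apply: (bilin_linr _ F2).
rewrite lcoact_coassoc; last by lin; [apply: F_l; lin | apply: F_r; lin].
apply: eq_sw => l x; apply: eq_sw => l1 l2.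
by rewrite lcoact_coassoc //; lin; [apply: F_l; lin | apply: F_r; lin].
Qed.

Lemma twist_mulA : associative twist_mul.
Proof.
move=> a b c; rewrite {1}/twist_mul.
have F2 (l : L) (x : A) : bilin (fun m (y : A) => σ (l ⊗ m) *: (x ∙ y)) by lin.
under eq_sw do rewrite (sw_lcoact_twist _ _ (F2 _ _)).
rewrite [RHS]/twist_mul.
have F2' : bilin (fun l (x : A) => \sw_(n, z <- lcoact c) σ (l ⊗ n) *: (x ∙ z)) by lin.
rewrite (sw_lcoact_twist _ _ F2').
apply: eq_sw => l x; apply: eq_sw => m y.
under [RHS]eq_sw do (under eq_sw do rewrite scale_sw; rewrite sw_exchange).
rewrite [RHS]sw_exchange.
apply: eq_sw => n z.
under [LHS]eq_sw do under eq_sw do rewrite scalerA amulA.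
under [RHS]eq_sw do under eq_sw do rewrite scalerA.
under [LHS]eq_sw do rewrite -sw_scale.
under [RHS]eq_sw do rewrite -sw_scale.
by rewrite -!sw_scale cocycleP.
Qed.

Lemma twist_mul1x : left_id (aone A) twist_mul.
Proof.
move=> a; rewrite /twist_mul lcoact1 sw_tens; last by lin.
under eq_sw do rewrite cocyclel1 amul1x.
by have [_ ->] := lcoactP A.
Qed.

Lemma twist_mulx1 : right_id (aone A) twist_mul.
Proof.
move=> a; rewrite /twist_mul lcoact1.
have F2 (l : L) (x : A) : bilin (fun m (y : A) => σ (l ⊗ m) *: (x ∙ y)) by lin.
under eq_sw do rewrite (sw_tens _ _ (F2 _ _)) cocycler1 amulx1.
by have [_ ->] := lcoactP A.
Qed.

Definition twist_alg : assocAlg k :=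
  AssocAlg twist_mulA twist_mul1x twist_mulx1 twist_mul_bilin.

Lemma bicoact_sw U (F : L -> A -> H -> U) a : trilin F ->
  \sw_(a0, h <- rcoact a) \sw_(l, a' <- lcoact a0) F l a' h =
  \sw_(l, a0 <- lcoact a) \sw_(a', h <- rcoact a0) F l a' h.
Proof.
move=> F3; have F3l := lift3_linear F3.
have := congr1 (lift3 F) (bicoactP a).
rewrite !(sw_map _ _ F3l) => e.
under eq_sw do under eq_sw do rewrite -(lift3_tens F3).
under [RHS]eq_sw do under eq_sw do rewrite -(lift3_tens F3).
under eq_sw do rewrite -(sw_map _ _ F3l).
by under [RHS]eq_sw do rewrite -(sw_map _ _ F3l).
Qed.

Lemma twist_rcoactM a b :
  rcoact (twist_mul a b) = tmul twist_mul *%R (rcoact a) (rcoact b).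
Proof.
rewrite (sw_twist (G := fun x => rcoact x)); last by lin.
under eq_sw do under eq_sw do
  (rewrite rcoactM /tmul scale_sw; under eq_sw do rewrite scale_sw).
under eq_sw do rewrite sw_exchange.
rewrite /tmul; have G_l (h : H) : linear (fun x : A => x ⊗ h) by lin.
under [RHS]eq_sw do
  (under eq_sw do rewrite (sw_twist _ _ (G_l _)); rewrite sw_exchange).
rewrite bicoact_sw; last by lin.
apply: eq_sw => l x; apply: eq_sw => x0 h.
by rewrite bicoact_sw //; lin.
Qed.

Definition twist : rcomodAlg H :=
  @RComodAlg k H twist_alg (rcoact : {linear A -> (A ⊗ H)%type})
    (rcoactP A) (rcoact1 A) twist_rcoactM.
End CocycleTwist.

(* Main.v *)
Require Import Defs.
From HB Require Import structures.
From mathcomp Require Import all_boot all_algebra.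
From mathcomp Require Import boolp classical_sets.

Set Implicit Arguments.
Unset Strict Implicit.
Unset Printing Implicit Defensive.

Import GRing.Theory.
Local Open Scope ring_scope.

(** Write B for the coinvariants of the H-comodule algebra A. The idea is to
    characterise principality by data that a twist visibly preserves
    ([principal_iff_total_integral]): when the antipode of H is bijective,
    A is principal if and only if

    - the lifted canonical map A ⊗ A -> A ⊗ H, a ⊗ a' |-> a a'0 ⊗ a'1, on the
      tensor product over the field, is surjective, and
    - there is a total integral, an H-colinear map j : H -> A with j 1 = 1.

    The second condition only involves the unit and the H-coaction of A, which
    the twist by sigma leaves unchanged. For the first one, let sigma act on
    A ⊗ A by a ⊗ a' |-> sigma(a_(-1) ⊗ a'_(-1)) a_0 ⊗ a'_0. As the coactions of
    K and H commute, the lifted canonical map of the twist is that of A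
    composed with this action ([lifted_can_twist]), and the action is
    bijective because sigma is convolution invertible ([cocycle_actK]). So
    one map is surjective exactly when the other is.

    The characterisation is proved as follows. Given a principal A, a linear
    retraction phi : A -> B and the section s of the product combine into a map
    A ⊗_B A -> A, a ⊗ a' |-> phi (a b) c with s a' = b ⊗ c; transported along
    the canonical bijection and evaluated on 1 ⊗ h, it is a total integral
    ([principal_total_integral]).

    Conversely, let j be a total integral. Surjectivity gives a linear lift
    H -> A ⊗ A of h |-> 1 ⊗ h. The retraction a ⊗ h |-> a0 j(S a1 h) of the
    coaction makes it colinear in the second factor; call the result
    l h = l' h ⊗ l'' h. Writing T for the inverse antipode, the elements
    a0 j(S a1 T x1) x0 are coinvariant, and
    s a = a00 j(S a01 T (l' a1)_1) (l' a1)_0 ⊗ l'' a1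
    is the required B-linear colinear section ([coinv_section]). The same
    formula exhibits a left inverse of the canonical map
    ([canonical_map_inj]). *)

(** * Linear algebra over a field *)

Lemma linear_comp (k : fieldType) (X V W : lmodType k) (f : V -> W) (g : X -> V) :
  linear f -> linear g -> linear (fun x => f (g x)).
Proof. by move=> fl gl c x y; rewrite gl fl. Qed.

Section LinearAlgebra.
Variable k : fieldType.
Implicit Types V W U : lmodType k.

Definition linear_bundle V W (f : V -> W) (fl : linear f) : {linear V -> W} :=
  HB.pack f (GRing.isLinear.Build k V W *:%R f fl).

(** Zorn's lemma gives a subspace maximal among those meeting N trivially;
    adjoining a vector outside N + C to such a C would contradict
    maximality, so C is a complement of N, and p is the projection along C. *)
Lemma linear_projection V (N : V -> Prop) :
  N 0 -> (forall c x y, N x -> N y -> N (c *: x + y)) ->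
  exists p : {linear V -> V}, (forall v, N (p v)) /\ forall v, N v -> p v = v.
Proof.
move=> N0 NP.
pose good (C : set V) := (forall c x y, C x -> C y -> C (c *: x + y)) /\
  forall v, C v -> N v -> v = 0.
have [F sF totF|C [[CP CN] Cmax]] := @Zorn_bigcup V good.
  split=> [c x y [X FX Xx] [Y FY Yy]|v [X FX Xv]].
    have [XY|YX] := totF X Y FX FY.
      by exists Y => //; apply: (sF Y FY).1 => //; apply: XY.
    by exists X => //; apply: (sF X FX).1 => //; apply: YX.
  exact: (sF X FX).2.
(* The union of the empty chain is empty, so the empty set has to be
   admitted among the candidates and is only now seen not to be maximal. *)
have C0 : C 0.
  apply: contrapT => nC0; apply: (Cmax (fun v => v = 0)); last first.
    by split=> [c x y -> ->|v -> //]; rewrite scaler0 addr0.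
  have CF v : ~ C v.
    by move=> Cv; apply: nC0; rewrite -(addNr v) -scaleN1r; apply: CP.
  by split=> [v /CF //|sub]; apply/(CF 0)/sub.
have NZ c x : N x -> N (c *: x) by move=> Nx; rewrite -[_ *: _]addr0; apply: NP.
have CZ c x : C x -> C (c *: x) by move=> Cx; rewrite -[_ *: _]addr0; apply: CP.
have CB x y : C x -> C y -> C (y - x) by move=> Cx Cy; rewrite addrC -scaleN1r; apply: CP.
have dec v : exists n, N n /\ C (v - n).
  apply: contrapT => nv.
  apply: (Cmax (fun w => exists c x, C x /\ w = c *: v + x)); last split.
  - split=> [w Cw|sub]; first by exists 0, w; rewrite scale0r add0r.
    apply: nv; exists 0; rewrite subr0; split=> //; apply: sub.
    by exists 1, 0; rewrite scale1r addr0.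
  - move=> c x y [d [x' [Cx ->]]] [e [y' [Cy ->]]].
    exists (c * d + e), (c *: x' + y'); split; first exact: CP.
    by rewrite scalerDr scalerA addrACA -scalerDl.
  - move=> w [c [x [Cx ->]]] Nw.
    have [c0|c0] := eqVneq c 0.
      by move: Nw; rewrite c0 scale0r add0r; apply: CN.
    case: nv; exists (c^-1 *: (c *: v + x)); split; first exact: NZ.
    rewrite scalerDr scalerA mulVf // scale1r opprD addNKr -scaleNr; exact: CZ.
have [p pP] := choice dec.
have pU v n : N n -> C (v - n) -> p v = n.
  move=> Nn Cn; have [Np Cp] := pP v; apply: subr0_eq.
  apply: CN; last by rewrite addrC -scaleN1r; apply: NP.
  by rewrite -(subrKA v) -[p v - v]opprB addrC; apply: CB.
have pl : linear p.
  move=> c x y; have [[Nx Cx] [Ny Cy]] := (pP x, pP y).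
  by apply: pU; [apply: NP | rewrite opprD addrACA -scalerBr; apply: CP].
exists (linear_bundle pl); split=> v /=; first by case: (pP v).
by move=> Nv; apply: pU => //; rewrite subrr.
Qed.

Lemma linear_factor V W U (f : {linear V -> W}) (T : {linear V -> U}) :
  (forall w, exists v, f v = w) -> (forall v, f v = 0 -> T v = 0) ->
  exists g : {linear W -> U}, forall v, g (f v) = T v.
Proof.
move=> /choice[r fr] ker.
have Tf x y : f x = f y -> T x = T y.
  by move=> e; apply/eqP; rewrite -subr_eq0 -linearB ker // linearB e subrr.
have gl : linear (fun w => T (r w)).
  by move=> c x y; rewrite -linearP; apply: Tf; rewrite linearP !fr.
by exists (linear_bundle gl) => v /=; apply: Tf; rewrite fr.
Qed.

(** The map [id - p], for p a projection onto the kernel of f, factors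
    through f; the factor is a section. *)
Lemma linear_section V W (f : {linear V -> W}) :
  (forall w, exists v, f v = w) ->
  exists g : {linear W -> V}, forall w, f (g w) = w.
Proof.
move=> fs.
have [|c x y fx fy|p [pk pid]] := @linear_projection V (fun v => f v = 0).
- exact: linear0.
- by rewrite linearP fx fy scaler0 addr0.
have ql : linear (fun v => v - p v).
  by move=> c x y; rewrite linearP opprD addrACA scalerBr.
have [v fv|g gE] := @linear_factor V W V f (linear_bundle ql) fs.
  by rewrite /= pid // subrr.
by exists g => w; have [v <-] := fs w; rewrite gE /= linearB pk subr0.
Qed.

End LinearAlgebra.

(** * Antipode identities in Sweedler form *)

(** Proves linearity and multilinearity of Sweedler expressions: what [lin]
    leaves is closed from the (multi)linearity hypotheses of the context. *)
Ltac multilin :=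
  lin; cbv beta;
  try match goal with
  | F2 : bilin ?F |- GRing.linear_for _ (fun x => ?F (@?g x) ?u) =>
      refine (@bilin_linl _ _ _ _ _ F g u F2 _); multilin
  | F2 : bilin ?F |- GRing.linear_for _ (fun x => ?F ?u (@?g x)) =>
      refine (@bilin_linr _ _ _ _ _ F g u F2 _); multilin
  | F2 : bilin ?F |- GRing.linear_for _ (?F ?u) => exact: (proj2 F2 u)
  | F2 : bilin ?F |- bilin ?F => exact: F2
  | F3 : trilin ?F |- GRing.linear_for _ (fun x => ?F (@?g x) ?u ?v) =>
      refine (linear_comp (g := g) (f := fun x => F x u v) _ _);
      [by case: F3 | multilin]
  | F3 : trilin ?F |- GRing.linear_for _ (fun x => ?F ?u (@?g x) ?v) =>
      refine (linear_comp (g := g) (f := fun x => F u x v) _ _);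
      [by case: F3 | multilin]
  | F3 : trilin ?F |- GRing.linear_for _ (fun x => ?F ?u ?v (@?g x)) =>
      refine (linear_comp (g := g) (f := F u v) _ _);
      [by case: F3 | multilin]
  | F3 : trilin ?F |- GRing.linear_for _ (?F ?u ?v) => by case: F3
  | F1 : linear ?F |- GRing.linear_for _ ?F => exact: F1
  | F1 : linear ?F |- GRing.linear_for _ (fun x => ?F (@?g x)) =>
      refine (linear_comp (g := g) F1 _); multilin
  end.

Section HopfIdentities.
Variables (k : fieldType) (H : hopfAlgType k).
Implicit Types (U : lmodType k) (g h : H).

Local Notation S := (antipode : H -> H).

Lemma comul_coassoc U (F : H -> H -> H -> U) h : trilin F ->
  \sw_(h1, h2 <- comul h) \sw_(h11, h12 <- comul h1) F h11 h12 h2 =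
  \sw_(h1, h2 <- comul h) \sw_(h21, h22 <- comul h2) F h1 h21 h22.
Proof.
move=> F3; have F3l := lift3_linear F3.
have := congr1 (lift3 F) (comulA h); rewrite !(sw_map _ _ F3l) => e.
under eq_sw do under eq_sw do rewrite -(lift3_tens F3).
under [RHS]eq_sw do under eq_sw do rewrite -(lift3_tens F3).
under eq_sw do rewrite -(sw_map _ _ F3l).
by under [RHS]eq_sw do rewrite -(sw_map _ _ F3l).
Qed.

Lemma comul_counitl U (F : H -> U) h : linear F ->
  \sw_(h1, h2 <- comul h) counit h1 *: F h2 = F h.
Proof.
move=> Fl; rewrite -[in RHS](counitl h) (sw_map _ _ Fl).
by apply: eq_sw => h1 h2; rewrite (linear_scale Fl).
Qed.

Lemma comul_counitr U (F : H -> U) h : linear F ->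
  \sw_(h1, h2 <- comul h) counit h2 *: F h1 = F h.
Proof.
move=> Fl; rewrite -[in RHS](counitr h) (sw_map _ _ Fl).
by apply: eq_sw => h1 h2; rewrite (linear_scale Fl).
Qed.

Lemma sw_antipodel U (F : H -> U) h : linear F ->
  \sw_(h1, h2 <- comul h) F (S h1 * h2) = counit h *: F 1.
Proof. by move=> Fl; rewrite -(sw_map _ _ Fl) antipodel (linear_scale Fl). Qed.

Lemma sw_antipoder U (F : H -> U) h : linear F ->
  \sw_(h1, h2 <- comul h) F (h1 * S h2) = counit h *: F 1.
Proof. by move=> Fl; rewrite -(sw_map _ _ Fl) antipoder (linear_scale Fl). Qed.

Lemma sw_comulM U (F : H -> H -> U) g h : bilin F ->
  sweedler (comul (g * h)) F =
  \sw_(g1, g2 <- comul g) \sw_(h1, h2 <- comul h) F (g1 * h1) (g2 * h2).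
Proof. by move=> F2; rewrite comulM tmulE. Qed.

Lemma sw_comul1 U (F : H -> H -> U) : bilin F -> sweedler (comul 1) F = F 1 1.
Proof. by move=> F2; rewrite comul1 sw_tens. Qed.

Lemma antipode1 : S 1 = 1.
Proof.
have := antipodel (1 : H); rewrite sw_comul1; last by multilin.
by rewrite mulr1 counit1 scale1r.
Qed.

(** The antipode reverses the comultiplication. In the convolution algebra
    Hom(H, H ⊗ H), the map h |-> comul (S h) is a left inverse of comul,
    while h |-> S h2 ⊗ S h1 is a right inverse ([cancel]), so they agree. *)
Lemma sw_comul_antipode U (F : H -> H -> U) h : bilin F ->
  sweedler (comul (S h)) F = \sw_(h1, h2 <- comul h) F (S h2) (S h1).
Proof.
move=> F2.
have cancel x y g : \sw_(g1, g2 <- comul g) \sw_(p, q <- comul g1)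
    \sw_(r, s <- comul g2) F (x * p * S s) (y * q * S r) = counit g *: F x y.
  rewrite comul_coassoc; last by multilin.
  under eq_sw do
    (rewrite -comul_coassoc; last by multilin).
  under eq_sw => p q.
    under eq_sw => r s.
      under eq_sw do rewrite -[y * _ * _]mulrA.
      rewrite (sw_antipoder (F := fun u => F (x * p * S s) (y * u))); last by multilin.
      rewrite mulr1; over.
    rewrite (comul_counitl (F := fun s => F (x * p * S s) y)); last by multilin.
    rewrite -mulrA; over.
  rewrite (sw_antipoder (F := fun u => F (x * u) y)); last by multilin.
  by rewrite mulr1.
pose G w g := \sw_(w1, w2 <- comul w) \sw_(r, s <- comul g) F (w1 * S s) (w2 * S r).
have G2 : bilin G by rewrite /G; multilin.
rewrite -[LHS](comul_counitr (F := fun h => sweedler (comul (S h)) F)); last by multilin.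
transitivity (\sw_(h1, h2 <- comul h) \sw_(h21, h22 <- comul h2) G (S h1 * h21) h22).
  apply: eq_sw => h1 h2; rewrite scale_sw.
  under eq_sw do rewrite -cancel.
  rewrite sw_exchange; apply: eq_sw => h21 h22.
  by rewrite /G sw_comulM; last by multilin.
rewrite -comul_coassoc; last by multilin.
under eq_sw do (rewrite (sw_antipodel (F := G^~ _)); last by multilin).
rewrite comul_counitl; last by multilin.
rewrite /G sw_comul1; last by multilin.
by apply: eq_sw => r s; rewrite !mul1r.
Qed.

(** The antipode reverses products: both sides are convolution inverses of
    the multiplication in Hom(H ⊗ H, H), one on each side. *)
Lemma antipodeM g h : S (g * h) = S h * S g.
Proof.
have mid x p r s q : x * (p * r) * (s * q) = x * (p * (r * s)) * q :> H.
  by rewrite !mulrA.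
have cancel x g' h' : \sw_(p, q <- comul g') \sw_(r, s <- comul h')
    x * (p * r) * (S s * S q) = counit g' *: (counit h' *: x).
  under eq_sw => p q.
    under eq_sw do rewrite mid.
    rewrite (sw_antipoder (F := fun u => x * (p * u) * S q)); last by multilin.
    rewrite mulr1 -mulrA; over.
  rewrite -scale_sw (sw_antipoder (F := fun u => x * u)); last by multilin.
  by rewrite mulr1 !scalerA mulrC.
transitivity (\sw_(g1, g2 <- comul g) \sw_(h1, h2 <- comul h)
    \sw_(p, q <- comul g2) \sw_(r, s <- comul h2)
      S (g1 * h1) * (p * r) * (S s * S q)).
  under [RHS]eq_sw do under eq_sw do rewrite cancel.
  under [RHS]eq_sw do (rewrite -scale_sw
    (comul_counitr (F := fun h' => S (_ * h'))); last by multilin).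
  by rewrite (comul_counitr (F := fun g' => S (g' * h))); last by multilin.
under eq_sw do rewrite sw_exchange.
rewrite -comul_coassoc; last by multilin.
under eq_sw do under eq_sw do (rewrite -comul_coassoc; last by multilin).
under eq_sw do (rewrite sw_exchange; under eq_sw do
  (rewrite -(sw_comulM (F := fun u v => S u * v * (S _ * S _))) //; last by multilin)).
under eq_sw do under eq_sw do (rewrite
  (sw_antipodel (F := fun u => u * (S _ * S _))) ?mul1r ?counitM -?scalerA;
  last by multilin).
under eq_sw do (rewrite -scale_sw (comul_counitl (F := fun h' => S h' * _));
  last by multilin).
by rewrite (comul_counitl (F := fun g' => S h * S g')); last by multilin.
Qed.

Section InverseAntipode.
Variable T : {linear H -> H}.
Hypotheses (TS : cancel S T) (ST : cancel T S).

Lemma sw_comul_inverse_antipode U (F : H -> H -> U) h : bilin F ->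
  sweedler (comul (T h)) F = \sw_(h1, h2 <- comul h) F (T h2) (T h1).
Proof.
move=> F2; rewrite -{2}(ST h) sw_comul_antipode; last by multilin.
by apply: eq_sw => h1 h2; rewrite !TS.
Qed.

(** The inverse T of the antipode is an antipode for the opposite product:
    apply the antimultiplicative T to S h1 * h2. *)
Lemma sw_inverse_antipodel U (F : H -> U) h : linear F ->
  \sw_(h1, h2 <- comul h) F (T h2 * h1) = counit h *: F 1.
Proof.
move=> Fl.
transitivity (\sw_(h1, h2 <- comul h) F (T (S h1 * h2))).
  by apply: eq_sw => h1 h2; rewrite -(TS (T h2 * _)) antipodeM ST.
rewrite (sw_antipodel (F := fun u => F (T u))); last by multilin.
by rewrite -{1}antipode1 TS.
Qed.

End InverseAntipode.
End HopfIdentities.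

(** * Comodule algebras and the lifted canonical map *)
Lemma sweedler0 (R : Type) (V W U : zmodType) (ra : V -> R -> V)
    (la : R -> W -> W) (f : V -> W -> U) :
  balanced ra la f -> sweedler (0 : btensor ra la) f = 0.
Proof.
by move=> fb; apply: (addrI (sweedler (0 : btensor ra la) f)); rewrite -sweedlerD // !addr0.
Qed.

Section ComoduleAlgebra.
Variables (k : fieldType) (H : hopfAlgType k) (A : rcomodAlg H).
Implicit Types (U : lmodType k) (a : A) (h : H).

Local Notation S := (antipode : H -> H).

Lemma rcoact_coassoc U (F : A -> H -> H -> U) a : trilin F ->
  \sw_(a0, a1 <- rcoact a) \sw_(a00, a01 <- rcoact a0) F a00 a01 a1 =
  \sw_(a0, a1 <- rcoact a) \sw_(h1, h2 <- comul a1) F a0 h1 h2.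
Proof.
move=> F3; have F3l := lift3_linear F3.
have := congr1 (lift3 F) ((rcoactP A).1 a); rewrite !(sw_map _ _ F3l) => e.
under eq_sw do under eq_sw do rewrite -(lift3_tens F3).
under [RHS]eq_sw do under eq_sw do rewrite -(lift3_tens F3).
under eq_sw do rewrite -(sw_map _ _ F3l).
by under [RHS]eq_sw do rewrite -(sw_map _ _ F3l).
Qed.

Lemma rcoact_counit U (F : A -> U) a : linear F ->
  \sw_(a0, a1 <- rcoact a) counit a1 *: F a0 = F a.
Proof.
move=> Fl; rewrite -[in RHS]((rcoactP A).2 a) (sw_map _ _ Fl).
by apply: eq_sw => a0 a1; rewrite (linear_scale Fl).
Qed.

Lemma sw_rcoactM U (F : A -> H -> U) a a' : bilin F ->
  sweedler (rcoact (a ∙ a')) F =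
  \sw_(a0, a1 <- rcoact a) \sw_(a'0, a'1 <- rcoact a') F (a0 ∙ a'0) (a1 * a'1).
Proof. by move=> F2; rewrite rcoactM tmulE. Qed.

Lemma sw_rcoact_coinv U (F : A -> H -> U) (b : coinv A) : bilin F ->
  sweedler (rcoact (val b)) F = F (val b) 1.
Proof. by move=> F2; rewrite coinvP sw_tens. Qed.

Lemma sw_rcoact_coinvM U (F : A -> H -> U) (b : coinv A) a : bilin F ->
  sweedler (rcoact (val b ∙ a)) F =
  \sw_(a0, a1 <- rcoact a) F (val b ∙ a0) a1.
Proof.
move=> F2; rewrite sw_rcoactM // sw_rcoact_coinv; last by multilin.
by apply: eq_sw => a0 a1; rewrite mul1r.
Qed.

Lemma val_coinv_linear : linear (val : coinv A -> A).
Proof. exact: linearP. Qed.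

Lemma coinv_mul_bilin : bilin (@coinv_mul k H A).
Proof.
split=> [b c x y|b c x y]; apply: val_inj; rewrite [RHS]val_coinv_linear.
  by rewrite -[LHS]/(val (c *: x + y) ∙ val b) val_coinv_linear (amul_bilin A).1.
by rewrite -[LHS]/(val b ∙ val (c *: x + y)) val_coinv_linear (amul_bilin A).2.
Qed.

(** The canonical map precomposed with the projection of A ⊗ A onto
    A ⊗_B A; its source does not depend on the product of A, which makes it
    the right object to compare A with its twists. *)
Definition lifted_can (x : A ⊗ A) : A ⊗ H :=
  \sw_(a, a' <- x) \sw_(a0, a1 <- rcoact a') (a ∙ a0) ⊗ a1.

Lemma lifted_can_linear : linear lifted_can.
Proof. by rewrite /lifted_can; multilin. Qed.

Lemma lifted_can_tens a a' :
  lifted_can (a ⊗ a') = \sw_(a0, a1 <- rcoact a') (a ∙ a0) ⊗ a1.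
Proof. by rewrite /lifted_can sw_tens; last by multilin. Qed.

Lemma sw_lifted_can U (F : A -> H -> U) x : bilin F ->
  sweedler (lifted_can x) F =
  \sw_(a, a' <- x) \sw_(a0, a1 <- rcoact a') F (a ∙ a0) a1.
Proof.
move=> F2; rewrite /lifted_can.
have Fl : linear (fun t : A ⊗ H => sweedler t F) by multilin.
rewrite (sw_map _ _ Fl); apply: eq_sw => a a'.
by rewrite (sw_map _ _ Fl); apply: eq_sw => a0 a1; rewrite sw_tens.
Qed.

Fact coinv1_subproof : aone A \in @is_coinv k H A.
Proof. by rewrite unfold_in rcoact1. Qed.

Definition coinv1 : coinv A := Coinv coinv1_subproof.

Local Notation rB := (fun (a : A) (b : coinv A) => a ∙ val b).
Local Notation lB := (fun (b : coinv A) (a : A) => val b ∙ a).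

(** Scalars act on A through the coinvariants c *: 1, so B-balanced maps are
    balanced over the field. *)
Lemma balanced_scalar (X : zmodType) (f : A -> A -> X) :
  balanced rB lB f ->
  balanced (fun a (c : k) => c *: a) (fun (c : k) a => c *: a) f.
Proof.
case=> fDl fDr fb; split=> // a c a'.
have -> : c *: a = a ∙ val (c *: coinv1).
  by rewrite (linear_scale val_coinv_linear)
     (linear_scale ((amul_bilin A).2 a)) amulx1.
by rewrite fb (linear_scale val_coinv_linear)
  (linear_scale ((amul_bilin A).1 a')) amul1x.
Qed.

Definition tensorB_proj (x : A ⊗ A) : tensorB A := sweedler x (btens rB lB).

Lemma tensorB_projD x y :
  tensorB_proj (x + y) = tensorB_proj x + tensorB_proj y.
Proof. exact/sweedlerD/balanced_scalar/btens_balanced. Qed.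

Lemma tensorB_proj_tens a a' : tensorB_proj (a ⊗ a') = btens rB lB a a'.
Proof. exact/sweedler_btens/balanced_scalar/btens_balanced. Qed.

Lemma tensorB_proj0 : tensorB_proj 0 = 0.
Proof. by apply: (addrI (tensorB_proj 0)); rewrite -tensorB_projD !addr0. Qed.

Lemma tensorB_proj_sw (V W : lmodType k) (t : V ⊗ W) (f : V -> W -> A ⊗ A) :
  tensorB_proj (sweedler t f) = \sw_(v, w <- t) tensorB_proj (f v w).
Proof. exact: (big_morph _ tensorB_projD tensorB_proj0). Qed.

Lemma tensorB_proj_surj z : exists x, tensorB_proj x = z.
Proof.
exists (\sum_(p <- repr z) p.1 ⊗ p.2).
rewrite [RHS]btensorE (big_morph _ tensorB_projD tensorB_proj0).
by apply: eq_bigr => p _; rewrite tensorB_proj_tens.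
Qed.

Lemma sw_tensorB_proj (U : lmodType k) (f : A -> A -> U) x : balanced rB lB f ->
  sweedler (tensorB_proj x) f = sweedler x f.
Proof.
move=> fb; elim/tensor_ind: x => [|a a' x IHx].
  by rewrite tensorB_proj0 !sweedler0 //; apply: balanced_scalar.
rewrite tensorB_projD tensorB_proj_tens !sweedlerD ?IHx //; last exact: balanced_scalar.
by rewrite !sweedler_btens //; apply: balanced_scalar.
Qed.

Lemma canonical_map_proj x : canonical_map (tensorB_proj x) = lifted_can x.
Proof. exact/sw_tensorB_proj/canonical_balanced. Qed.

Definition total_integral (j : {linear H -> A}) : Prop :=
  j 1 = aone A /\
  forall h, rcoact (j h) = \sw_(h1, h2 <- comul h) j h1 ⊗ h2.

Lemma sw_total_integral j U (F : A -> H -> U) h : total_integral j -> bilin F ->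
  sweedler (rcoact (j h)) F = \sw_(h1, h2 <- comul h) F (j h1) h2.
Proof.
move=> [_ ->] F2; rewrite (sw_map (g := fun t : A ⊗ H => sweedler t F)); last by multilin.
by apply: eq_sw => h1 h2; rewrite sw_tens.
Qed.

End ComoduleAlgebra.

(** * From principality to a total integral *)
Section PrincipalToIntegral.
Variables (k : fieldType) (H : hopfAlgType k) (A : rcomodAlg H).
Variable s : {linear A -> (coinv A ⊗ A)%type}.
Hypothesis galA : hopf_galois A.
Hypothesis s_coinv : forall b a, s (val b ∙ a) = coinv_act b (s a).
Hypothesis s_colinear :
  forall a, coinv_coact (s a) = \sw_(a0, a1 <- rcoact a) s a0 ⊗ a1.
Hypothesis s_mul : forall a, \sw_(b, a' <- s a) val b ∙ a' = a.
Implicit Types U : lmodType k.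

Lemma hopf_galois_lifted_can_surj (y : A ⊗ H) : exists x, lifted_can x = y.
Proof.
have [inv _ can_inv] := galA.
have [x xE] := tensorB_proj_surj (inv y); exists x.
by rewrite -canonical_map_proj xE.
Qed.

Lemma coinv_retraction :
  exists phi : {linear A -> coinv A}, forall b, phi (val b) = b.
Proof.
have [|c x y|p [pB pid]] := @linear_projection k A (fun a => a \in @is_coinv k H A).
- exact: rpred0.
- by move=> xB yB; rewrite rpredD ?rpredZ.
have phil : linear (fun a => Coinv (pB a)).
  by move=> c x y; apply: val_inj; rewrite val_coinv_linear /= linearP.
exists (linear_bundle phil) => b; apply: val_inj => /=.
by rewrite pid //; apply: valP.
Qed.

Lemma sw_section_colinear U (F : coinv A -> A -> H -> U) a : trilin F ->
  \sw_(b, c <- s a) \sw_(c0, c1 <- rcoact c) F b c0 c1 =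
  \sw_(a0, a1 <- rcoact a) \sw_(b, c <- s a0) F b c a1.
Proof.
move=> F3.
pose G (t : (coinv A ⊗ A) ⊗ H) := \sw_(u, h <- t) \sw_(b, c <- u) F b c h.
have G2 : bilin (fun (u : coinv A ⊗ A) h => \sw_(b, c <- u) F b c h) by multilin.
have Gl : linear G by rewrite /G; multilin.
have := congr1 G (s_colinear a); rewrite /coinv_coact !(sw_map _ _ Gl) => e.
transitivity (\sw_(b, c <- s a) G (\sw_(c0, c1 <- rcoact c) (b ⊗ c0) ⊗ c1)).
  apply: eq_sw => b c; rewrite (sw_map _ _ Gl); apply: eq_sw => c0 c1.
  by rewrite /G (sw_tens _ _ G2) sw_tens; last by multilin.
rewrite e; apply: eq_sw => a0 a1.
by rewrite /G (sw_tens _ _ G2).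
Qed.

(** With phi a linear retraction of B in A, the B-balanced map
    a ⊗ a' |-> phi (a b) c, where s a' = b ⊗ c, factors through the bijective
    canonical map; the factor g is H-colinear since s is, and
    j h = g (1 ⊗ h) is unital because phi fixes the coinvariants occurring
    in s 1. *)
Lemma principal_total_integral : exists j : {linear H -> A}, total_integral j.
Proof.
have [phi phiK] := coinv_retraction.
have vl := @val_coinv_linear k H A.
pose f (a a' : A) := \sw_(b, c <- s a') (val (phi (a ∙ val b)) ∙ c).
have f2 : bilin f by rewrite /f; multilin.
have fb : balanced (fun (a : A) (b : coinv A) => a ∙ val b)
                   (fun (b : coinv A) (a : A) => val b ∙ a) f.
  split=> [a a' x|a a' x|a b a'].
  - exact: (linear_add (f2.1 x)).
  - exact: (linear_add (f2.2 a)).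
  rewrite /f s_coinv /coinv_act.
  have Fl : linear (fun t : coinv A ⊗ A =>
      \sw_(b, c <- t) (val (phi (a ∙ val b)) ∙ c)) by multilin.
  rewrite [RHS](sw_map _ _ Fl); apply: eq_sw => b' c.
  by rewrite sw_tens /=; [rewrite amulA | multilin].
have Tl : linear (fun x : A ⊗ A => sweedler x f) by multilin.
have [|x|g gE] := @linear_factor k _ _ _ (linear_bundle (@lifted_can_linear k H A))
    (linear_bundle Tl).
- exact: hopf_galois_lifted_can_surj.
- rewrite /= -canonical_map_proj => can0; rewrite -sw_tensorB_proj //.
  suff -> : tensorB_proj x = 0 by rewrite sweedler0.
  apply: (bij_inj galA); rewrite can0 /canonical_map sweedler0 //.
  exact: canonical_balanced.
have gcan x : g (lifted_can x) = sweedler x f by apply: gE.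
have jl : linear (fun h : H => g (aone A ⊗ h)) by multilin.
exists (linear_bundle jl); split=> [|h] /=.
  transitivity (g (lifted_can (aone A ⊗ aone A))).
    by rewrite lifted_can_tens rcoact1 sw_tens ?amul1x; last by multilin.
  rewrite gcan sw_tens // /f -[RHS]s_mul; apply: eq_sw => b c.
  by rewrite amul1x phiK.
(* Colinearity can be tested on the image of the lifted canonical map,
   where it is the colinearity of s. *)
have gcolin y : rcoact (g y) =
    \sw_(a, h <- y) \sw_(h1, h2 <- comul h) g (a ⊗ h1) ⊗ h2.
  have [x <-] := hopf_galois_lifted_can_surj y.
  rewrite gcan sw_lifted_can; last by multilin.
  rewrite (sw_map (g := rcoact)); last by multilin.
  apply: eq_sw => a a'; rewrite -rcoact_coassoc; last by multilin.
  transitivity (\sw_(b, c <- s a') \sw_(c0, c1 <- rcoact c)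
      (val (phi (a ∙ val b)) ∙ c0) ⊗ c1).
    rewrite /f (sw_map (g := rcoact)); last by multilin.
    apply: eq_sw => b c; rewrite -[LHS]sw_id sw_rcoact_coinvM //; last by multilin.
  rewrite sw_section_colinear; last by multilin.
  apply: eq_sw => a0 a1.
  have tl : linear (fun c : A => c ⊗ a1) by multilin.
  rewrite -!(sw_map _ _ tl) -(sw_map (g := g)); last by multilin.
  by rewrite -lifted_can_tens gcan sw_tens.
by rewrite gcolin sw_tens; last by multilin.
Qed.

End PrincipalToIntegral.

(** * From a total integral to principality *)
Section IntegralToPrincipal.
Variables (k : fieldType) (H : hopfAlgType k) (A : rcomodAlg H).
Variables (T : {linear H -> H}) (j : {linear H -> A}).
Variable lift : {linear H -> (A ⊗ A)%type}.
Local Notation S := (antipode : H -> H).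
Hypotheses (TS : cancel S T) (ST : cancel T S).
Hypothesis j_int : total_integral j.
Hypothesis can_lift : forall h, lifted_can (lift h) = aone A ⊗ h.
Implicit Types (U : lmodType k) (a x : A) (h : H).

(** An H-colinear retraction of the coaction A -> A ⊗ H, where H coacts on
    the second factor of A ⊗ H: the total integral makes A an injective
    comodule. *)
Definition coact_retract a h : A := \sw_(a0, a1 <- rcoact a) a0 ∙ j (S a1 * h).

Lemma coact_retract_bilin : bilin coact_retract.
Proof. by rewrite /coact_retract; multilin. Qed.

Lemma sw_rcoact_retract U (F : A -> H -> U) a h : bilin F ->
  sweedler (rcoact (coact_retract a h)) F =
  \sw_(h1, h2 <- comul h) F (coact_retract a h1) h2.
Proof.
move=> F2; rewrite /coact_retract.
rewrite (sw_map (g := fun u => sweedler (rcoact u) F)); last by multilin.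
transitivity (\sw_(a0, a1 <- rcoact a) \sw_(a00, a01 <- rcoact a0)
    \sw_(x, y <- comul a1) \sw_(h1, h2 <- comul h)
      F (a00 ∙ j (S y * h1)) (a01 * (S x * h2))).
  apply: eq_sw => a0 a1; rewrite sw_rcoactM //; apply: eq_sw => a00 a01.
  rewrite sw_total_integral //; last by multilin.
  rewrite sw_comulM; last by multilin.
  by rewrite sw_comul_antipode; last by multilin.
rewrite rcoact_coassoc; last by multilin.
transitivity (\sw_(a0, a1 <- rcoact a) \sw_(h1, h2 <- comul h) F (a0 ∙ j (S a1 * h1)) h2).
  apply: eq_sw => a0 a1; rewrite -comul_coassoc; last by multilin.
  under eq_sw do rewrite sw_exchange.
  rewrite sw_exchange; apply: eq_sw => h1 h2.
  under eq_sw => v y.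
    under eq_sw do rewrite mulrA.
    rewrite (sw_antipoder (F := fun u => F (a0 ∙ j (S y * h1)) (u * h2))); last by multilin.
    rewrite mul1r; over.
  by rewrite (comul_counitl (F := fun y => F (a0 ∙ j (S y * h1)) h2)); last by multilin.
rewrite sw_exchange; apply: eq_sw => h1 h2.
by rewrite -(sw_map (g := F^~ h2)); last by multilin.
Qed.

Lemma coact_retract_coact a : \sw_(a0, a1 <- rcoact a) coact_retract a0 a1 = a.
Proof.
rewrite /coact_retract rcoact_coassoc; last by multilin.
under eq_sw do (rewrite (sw_antipodel (F := fun u => _ ∙ j u)) ?j_int.1 ?amulx1;
  last by multilin).
exact: (rcoact_counit (F := id)).
Qed.

(** The linear lift h |-> lift h of 1 ⊗ h becomes H-colinear, for the
    coaction on the second tensor factor, after applying the colinear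
    retraction to that factor; it remains a lift because the lifted
    canonical map is itself colinear. *)
Definition strong_lift h : A ⊗ A :=
  \sw_(h1, h2 <- comul h) \sw_(x, y <- lift h1) x ⊗ coact_retract y h2.

Lemma strong_lift_linear : linear strong_lift.
Proof. by have r2 := coact_retract_bilin; rewrite /strong_lift; multilin. Qed.

Lemma sw_strong_lift U (F : A -> A -> U) h : bilin F ->
  sweedler (strong_lift h) F =
  \sw_(h1, h2 <- comul h) \sw_(x, y <- lift h1) F x (coact_retract y h2).
Proof.
move=> F2; have Fl : linear (fun t : A ⊗ A => sweedler t F) by multilin.
rewrite /strong_lift (sw_map _ _ Fl); apply: eq_sw => h1 h2.
by rewrite (sw_map _ _ Fl); apply: eq_sw => x y; rewrite sw_tens.
Qed.

Lemma strong_lift_colinear U (F : A -> A -> H -> U) h : trilin F ->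
  \sw_(x, y <- strong_lift h) \sw_(y0, y1 <- rcoact y) F x y0 y1 =
  \sw_(h1, h2 <- comul h) \sw_(x, y <- strong_lift h1) F x y h2.
Proof.
move=> F3; have r2 := coact_retract_bilin.
rewrite sw_strong_lift; last by multilin.
transitivity (\sw_(h1, h2 <- comul h) \sw_(p, q <- comul h2)
    \sw_(x, y <- lift h1) F x (coact_retract y p) q).
  apply: eq_sw => h1 h2; rewrite sw_exchange; apply: eq_sw => x y.
  by rewrite sw_rcoact_retract; last by multilin.
rewrite -comul_coassoc; last by multilin.
by apply: eq_sw => h1 h2; rewrite sw_strong_lift; last by multilin.
Qed.

(** Since lift h maps to 1 ⊗ h, the product x y over strong_lift h is
    j (S h1 h2). *)
Lemma strong_lift_mul U (F : A -> U) h : linear F ->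
  \sw_(x, y <- strong_lift h) F (x ∙ y) = counit h *: F (aone A).
Proof.
move=> Fl; have r2 := coact_retract_bilin.
rewrite sw_strong_lift; last by multilin.
transitivity (\sw_(h1, h2 <- comul h) F (j (S h1 * h2))).
  apply: eq_sw => h1 h2.
  transitivity (sweedler (lifted_can (lift h1)) (fun a u => F (a ∙ j (S u * h2)))).
    rewrite sw_lifted_can; last by multilin.
    apply: eq_sw => x y; rewrite /coact_retract.
    rewrite (sw_map (g := fun u => F (x ∙ u))); last by multilin.
    by apply: eq_sw => y0 y1; rewrite amulA.
  by rewrite can_lift sw_tens ?amul1x; last by multilin.
by rewrite (sw_antipodel (F := fun u => F (j u))) ?j_int.1; last by multilin.
Qed.

Lemma lifted_can_strong_lift h : lifted_can (strong_lift h) = aone A ⊗ h.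
Proof.
rewrite /lifted_can strong_lift_colinear; last by multilin.
under eq_sw do (rewrite (strong_lift_mul (F := fun u => u ⊗ _)); last by multilin).
by rewrite (comul_counitl (F := fun u => aone A ⊗ u)); last by multilin.
Qed.

(** Coacting on the A-factor of x y0 ⊗ y1 = 1 ⊗ h and cancelling the
    coefficients of y against the antipode determines the coefficients
    of x. *)
Lemma strong_lift_rcoactl U (F : A -> H -> U) h : bilin F ->
  \sw_(x, y <- strong_lift h) \sw_(x0, x1 <- rcoact x) F (x0 ∙ y) x1 =
  F (aone A) (S h).
Proof.
move=> F2.
pose G a h := \sw_(a0, a1 <- rcoact a) F a0 (a1 * S h).
have G2 : bilin G by rewrite /G; multilin.
transitivity (sweedler (lifted_can (strong_lift h)) G); last first.
  rewrite lifted_can_strong_lift sw_tens // /G rcoact1 sw_tens ?mul1r //.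
  by multilin.
rewrite sw_lifted_can //; apply: eq_sw => x y; rewrite /G.
transitivity (\sw_(y0, y1 <- rcoact y) \sw_(y00, y01 <- rcoact y0)
    \sw_(x0, x1 <- rcoact x) F (x0 ∙ y00) (x1 * (y01 * S y1))); last first.
  apply: eq_sw => y0 y1; rewrite sw_rcoactM; last by multilin.
  by rewrite sw_exchange; do 2!apply: eq_sw => ? ?; rewrite mulrA.
rewrite rcoact_coassoc; last by multilin.
under [RHS]eq_sw do rewrite sw_exchange.
rewrite [RHS]sw_exchange; apply: eq_sw => x0 x1.
under [RHS]eq_sw do (rewrite (sw_antipoder (F := fun u => F (x0 ∙ _) (x1 * u)));
  last by multilin).
rewrite (rcoact_counit (F := fun u => F (x0 ∙ u) (x1 * 1))) ?mulr1 //.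
by multilin.
Qed.

(** For T the inverse antipode this is a0 j(S a1 T x1) x0. Its coefficient
    of x and the coefficient produced by the retraction cancel, so it takes
    values in B; it is left B-linear in a. *)
Definition average a x : A :=
  \sw_(x0, x1 <- rcoact x) coact_retract a (T x1) ∙ x0.

Lemma average_bilin : bilin average.
Proof.
by have r2 := coact_retract_bilin; rewrite /average; multilin.
Qed.

Fact average_coinv a x : average a x \in @is_coinv k H A.
Proof.
have r2 := coact_retract_bilin.
rewrite unfold_in; apply/eqP; rewrite -[LHS]sw_id.
pose G (u : A) : A ⊗ H := \sw_(v, w <- rcoact u) v ⊗ w.
have Gl : linear G by rewrite /G; multilin.
rewrite -/(G _) /average (sw_map _ _ Gl).
transitivity (\sw_(x0, x1 <- rcoact x) \sw_(x00, x01 <- rcoact x0)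
    \sw_(d, e <- comul x1) (coact_retract a (T e) ∙ x00) ⊗ (T d * x01)).
  apply: eq_sw => x0 x1; rewrite /G sw_rcoactM; last by multilin.
  rewrite sw_rcoact_retract; last by multilin.
  rewrite sw_comul_inverse_antipode //; last by multilin.
  by rewrite sw_exchange.
rewrite rcoact_coassoc; last by multilin.
have tl : linear (fun u : A => u ⊗ (1 : H)) by multilin.
rewrite (sw_map _ _ tl); apply: eq_sw => x0 x1.
rewrite -comul_coassoc; last by multilin.
under eq_sw do (rewrite
  (sw_inverse_antipodel TS ST (F := fun u => (coact_retract a (T _) ∙ x0) ⊗ u));
  last by multilin).
by rewrite (comul_counitl (F := fun u => (coact_retract a (T u) ∙ x0) ⊗ 1));
  last by multilin.
Qed.

Definition coinv_average a x : coinv A := Coinv (average_coinv a x).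

Lemma coinv_average_bilin : bilin coinv_average.
Proof.
have [Ql Qr] := average_bilin.
split=> [x c a b|a c x y]; apply: val_inj; rewrite val_coinv_linear /=.
  exact: Ql.
exact: Qr.
Qed.

Lemma coinv_average_coinvM b a x :
  coinv_average (val b ∙ a) x = coinv_mul b (coinv_average a x).
Proof.
have r2 := coact_retract_bilin.
apply: val_inj; rewrite /= /average (sw_map (g := amul (val b))); last by multilin.
apply: eq_sw => x0 x1; rewrite amulA; congr (_ ∙ _); rewrite /coact_retract.
rewrite sw_rcoact_coinvM; last by multilin.
rewrite (sw_map (g := amul (val b))); last by multilin.
by apply: eq_sw => a0 a1; rewrite amulA.
Qed.

(** By [strong_lift_rcoactl] the factors x0 y ⊗ T x1 contract to 1 ⊗ h. *)
Lemma average_strong_lift a h :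
  \sw_(x, y <- strong_lift h) (average a x ∙ y) = coact_retract a h.
Proof.
have r2 := coact_retract_bilin.
have tr u : linear (amul^~ u : A -> A) by multilin.
rewrite -[in RHS](TS h) -[RHS]amulx1.
rewrite -(strong_lift_rcoactl (F := fun u v => coact_retract a (T v) ∙ u)); last by multilin.
apply: eq_sw => x y; rewrite /average (sw_map _ _ (tr _)).
by apply: eq_sw => x0 x1; rewrite amulA.
Qed.

(** The section a |-> a0 ⊗ strong_lift a1 of the product A ⊗ A -> A,
    with its first two factors averaged into B. *)
Definition coinv_section a : (coinv A ⊗ A)%type :=
  \sw_(a0, a1 <- rcoact a) \sw_(x, y <- strong_lift a1) coinv_average a0 x ⊗ y.

Lemma coinv_section_linear : linear coinv_section.
Proof.
have q2 := coinv_average_bilin; have l1 := strong_lift_linear.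
by rewrite /coinv_section; multilin.
Qed.

Lemma sw_coinv_section U (F : coinv A -> A -> U) a : bilin F ->
  sweedler (coinv_section a) F =
  \sw_(a0, a1 <- rcoact a) \sw_(x, y <- strong_lift a1) F (coinv_average a0 x) y.
Proof.
move=> F2; have Fl : linear (fun t : coinv A ⊗ A => sweedler t F) by multilin.
rewrite /coinv_section (sw_map _ _ Fl); apply: eq_sw => a0 a1.
by rewrite (sw_map _ _ Fl); apply: eq_sw => x y; rewrite sw_tens.
Qed.

Lemma coinv_section_coinv b a :
  coinv_section (val b ∙ a) = coinv_act b (coinv_section a).
Proof.
have q2 := coinv_average_bilin; have l1 := strong_lift_linear.
have m2 := @coinv_mul_bilin k H A.
rewrite /coinv_act sw_coinv_section; last by multilin.
rewrite /coinv_section sw_rcoact_coinvM; last by multilin.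
by do 2!apply: eq_sw => ? ?; rewrite coinv_average_coinvM.
Qed.

Lemma coinv_section_colinear a :
  coinv_coact (coinv_section a) =
  \sw_(a0, a1 <- rcoact a) coinv_section a0 ⊗ a1.
Proof.
have q2 := coinv_average_bilin; have l1 := strong_lift_linear.
have tl (h : H) : linear (fun u : (coinv A ⊗ A)%type => u ⊗ h) by multilin.
rewrite /coinv_coact sw_coinv_section; last by multilin.
under eq_sw do (rewrite strong_lift_colinear; last by multilin).
rewrite -rcoact_coassoc; last by multilin.
apply: eq_sw => a0 a1; rewrite /coinv_section (sw_map _ _ (tl _)).
by apply: eq_sw => a00 a01; rewrite (sw_map _ _ (tl _)).
Qed.

Lemma coinv_section_mul a : \sw_(b, a' <- coinv_section a) val b ∙ a' = a.
Proof.
have vl := @val_coinv_linear k H A.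
rewrite sw_coinv_section; last by multilin.
under eq_sw do rewrite average_strong_lift.
exact: coact_retract_coact.
Qed.

(** Modulo B-balancing, a ⊗ a' is the product of a with
    coinv_section a', and that expression depends on a ⊗ a' only through
    its image under the canonical map: G recovers it from this image. *)
Lemma canonical_map_inj : injective (@canonical_map k H A).
Proof.
have r2 := coact_retract_bilin; have l1 := strong_lift_linear.
have vl := @val_coinv_linear k H A.
pose G (y : A ⊗ H) : A ⊗ A := \sw_(c, h <- y) \sw_(h1, h2 <- comul h)
  \sw_(x, z <- strong_lift h2) \sw_(x0, x1 <- rcoact x)
    (c ∙ (j (S h1 * T x1) ∙ x0)) ⊗ z.
have GE (x : A ⊗ A) : tensorB_proj (G (lifted_can x)) = tensorB_proj x.
  have Gl : linear G by rewrite /G; multilin.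
  have cl := @lifted_can_linear k H A.
  elim/tensor_ind: x => [|a a' x IHx].
    suff -> : G (lifted_can 0) = 0 by [].
    by rewrite -[0](scale0r (0 : A ⊗ A)) (linear_scale cl) (linear_scale Gl) !scale0r.
  rewrite (linear_add cl) (linear_add Gl) !tensorB_projD IHx; congr (_ + _).
  rewrite lifted_can_tens (sw_map _ _ Gl).
  have -> : \sw_(a'0, a'1 <- rcoact a') G ((a ∙ a'0) ⊗ a'1) =
      \sw_(b, c <- coinv_section a') (a ∙ val b) ⊗ c.
    rewrite sw_coinv_section; last by multilin.
    under eq_sw do (rewrite /G sw_tens; last by multilin).
    rewrite -rcoact_coassoc; last by multilin.
    apply: eq_sw => a0 a1; rewrite sw_exchange; apply: eq_sw => x' y.
    have tl : linear (fun u : A => (a ∙ u) ⊗ y) by multilin.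
    rewrite /= /average (sw_map _ _ tl) sw_exchange.
    apply: eq_sw => x0 x1; rewrite /coact_retract.
    rewrite (sw_map (g := fun u : A => (a ∙ (u ∙ x0)) ⊗ y)); last by multilin.
    by apply: eq_sw => a00 a01; rewrite !amulA.
  rewrite tensorB_proj_sw; under eq_sw do rewrite tensorB_proj_tens.
  have [_ bDr bb] := btens_balanced (fun (a : A) (b : coinv A) => a ∙ val b)
    (fun (b : coinv A) (a : A) => val b ∙ a).
  rewrite tensorB_proj_tens -{2}(coinv_section_mul a').
  under eq_sw do rewrite bb.
  have b0 : btens (fun (a : A) (b : coinv A) => a ∙ val b)
    (fun (b : coinv A) (a : A) => val b ∙ a) a 0 = 0.
    by apply: (addrI (btens _ _ a 0)); rewrite -bDr !addr0.
  by apply/esym; exact: (big_morph _ (bDr a) b0).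
move=> x y; have [x' <-] := tensorB_proj_surj x.
have [y' <-] := tensorB_proj_surj y.
by rewrite !canonical_map_proj -(GE x') -(GE y') => ->.
Qed.

End IntegralToPrincipal.

(** Schneider's criterion: the B-linear colinear section and the injectivity
    of the canonical map are traded for a condition on the H-comodule A and
    its unit, together with surjectivity over the ground field. *)
Theorem principal_iff_total_integral (k : fieldType) (H : hopfAlgType k)
    (A : rcomodAlg H) : bijective (antipode : H -> H) ->
  principal A <->
  (forall y, exists x : (A ⊗ A)%type, lifted_can x = y) /\
  exists j : {linear H -> A}, total_integral j.
Proof.
move=> [T0 TS0 ST0]; split=> [[galA [s [s1 s2 s3]]]|[can_surj [j j_int]]].
  split; first exact: hopf_galois_lifted_can_surj.
  exact: principal_total_integral s2 s3.
have T0l : linear T0.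
  by move=> c x y; apply: (can_inj TS0); rewrite linearP !ST0.
pose T := linear_bundle T0l.
have TS : cancel antipode T by [].
have ST : cancel T antipode by [].
have [g gE] :=
  @linear_section k _ _ (linear_bundle (@lifted_can_linear k H A)) can_surj.
have gl : linear (fun h : H => g (aone A ⊗ h)) by multilin.
pose lift := linear_bundle gl.
have liftE h : lifted_can (lift h) = aone A ⊗ h by exact: gE.
split.
  have can_inj := canonical_map_inj TS ST j_int liftE.
  exists (fun y => tensorB_proj (g y)) => [x|y]; last first.
    by rewrite canonical_map_proj; apply: gE.
  by apply: can_inj; rewrite canonical_map_proj; apply: gE.
exists (linear_bundle (coinv_section_linear lift TS ST j_int)).
split=> [b a|a|a] /=.
- exact: coinv_section_coinv.
- exact: coinv_section_colinear.
- exact: coinv_section_mul.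
Qed.

(** * Twisting *)
Section TwistCanonicalMap.
Variables (k : fieldType) (K H : hopfAlgType k) (A : bicomodAlg K H).

(** The action of functionals on K ⊗ K on the left K ⊗ K-comodule A ⊗ A. *)
Definition cocycle_act (f : {scalar (K ⊗ K)%type}) (x : A ⊗ A) : A ⊗ A :=
  \sw_(a, a' <- x) \sw_(l, a0 <- lcoact a) \sw_(m, a'0 <- lcoact a')
    f (l ⊗ m) *: (a0 ⊗ a'0).

Lemma sw_cocycle_act (U : lmodType k) (F : A -> A -> U) f x : bilin F ->
  sweedler (cocycle_act f x) F =
  \sw_(a, a' <- x) \sw_(l, a0 <- lcoact a) \sw_(m, a'0 <- lcoact a')
    f (l ⊗ m) *: F a0 a'0.
Proof.
move=> F2; have Fl : linear (fun t : A ⊗ A => sweedler t F) by multilin.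
rewrite /cocycle_act (sw_map _ _ Fl); apply: eq_sw => a a'.
rewrite (sw_map _ _ Fl); apply: eq_sw => l a0.
rewrite (sw_map _ _ Fl); apply: eq_sw => m a'0.
by rewrite (linear_scale Fl) sw_tens.
Qed.

Lemma cocycle_actK f g : convolution_inverse f g ->
  cancel (cocycle_act f) (cocycle_act g).
Proof.
move=> fg x; rewrite {1}/cocycle_act sw_cocycle_act; last by multilin.
rewrite -[RHS]sw_id; apply: eq_sw => a a'.
transitivity (\sw_(l, a0 <- lcoact a) \sw_(l', a00 <- lcoact a0)
   \sw_(m, a'0 <- lcoact a') \sw_(m', a'00 <- lcoact a'0)
     (f (l ⊗ m) * g (l' ⊗ m')) *: (a00 ⊗ a'00)).
  apply: eq_sw => l a0; rewrite [RHS]sw_exchange; apply: eq_sw => m a'0.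
  rewrite scale_sw; apply: eq_sw => l' a00.
  by rewrite scale_sw; apply: eq_sw => m' a'00; rewrite scalerA.
under eq_sw do under eq_sw do under eq_sw do under eq_sw do rewrite -scalerA.
rewrite lcoact_coassoc; last by multilin.
transitivity (\sw_(l, a0 <- lcoact a) \sw_(m, a'0 <- lcoact a')
    counit l *: (counit m *: (a0 ⊗ a'0))).
  apply: eq_sw => l a0.
  under eq_sw do (rewrite lcoact_coassoc; last by multilin).
  rewrite sw_exchange; apply: eq_sw => m a'0.
  rewrite [RHS]scalerA -fg sw_scale; apply: eq_sw => l1 l2.
  by rewrite sw_scale; apply: eq_sw => m1 m2; rewrite scalerA.
have cl := (lcoactP A).2.
have tl u : linear (tens u : A -> A ⊗ A) by multilin.
have tr u : linear (fun v => v ⊗ u : A ⊗ A) by multilin.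
rewrite -[in RHS](cl a) (sw_map _ _ (tr a')); apply: eq_sw => l a0.
rewrite (linear_scale (tr a')) -scale_sw; congr (_ *: _).
rewrite -[in RHS](cl a') (sw_map _ _ (tl a0)); apply: eq_sw => m a'0.
by rewrite (linear_scale (tl a0)).
Qed.

(** The two coactions commute, so acting by sigma before or after coacting
    with H on the second factor gives the same twisted product. *)
Lemma lifted_can_twist (sigma : cocycle K) (x : A ⊗ A) :
  @lifted_can k H (twist A sigma) x = lifted_can (cocycle_act sigma x).
Proof.
rewrite [RHS]/lifted_can sw_cocycle_act; last by multilin.
rewrite /lifted_can; apply: eq_sw => a a'.
transitivity (\sw_(a'0, h <- rcoact a') \sw_(l, a0 <- lcoact a)
    \sw_(m, a'00 <- lcoact a'0) sigma (l ⊗ m) *: ((a0 ∙ a'00) ⊗ h)).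
  apply: eq_sw => a'0 h.
  have tl : linear (fun u : A => u ⊗ h) by multilin.
  exact: (sw_twist sigma a a'0 tl).
rewrite sw_exchange; apply: eq_sw => l a0.
rewrite bicoact_sw; last by multilin.
by apply: eq_sw => m a'0; rewrite scale_sw.
Qed.

Lemma lifted_can_twist_surj (sigma : cocycle K) :
  (forall y, exists x : (A ⊗ A)%type, lifted_can x = y) <->
  (forall y, exists x, @lifted_can k H (twist A sigma) x = y).
Proof.
have [tau [st ts]] := cocycle_inv sigma.
split=> can_surj y; have [x xE] := can_surj y.
  by exists (cocycle_act tau x); rewrite lifted_can_twist (cocycle_actK ts).
by exists (cocycle_act sigma x); rewrite -lifted_can_twist.
Qed.

End TwistCanonicalMap.

Theorem corollary3p19 (k : fieldType) (H K : hopfAlgType k)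
    (antipode_bij : bijective (antipode : H -> H))
    (A : bicomodAlg K H) (B_subcomodule : coinv_subcomodule A)
    (sigma : cocycle K) :
  principal A <-> principal (twist A sigma).
Proof.
have pA := principal_iff_total_integral A antipode_bij.
have pT := principal_iff_total_integral (twist A sigma) antipode_bij.
have can_iff := lifted_can_twist_surj A sigma.
by split=> [/pA[/can_iff sA jA]|/pT[/can_iff sA jA]]; [apply/pT | apply/pA].
Qed.
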